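(* Let $D$ be a locally countable Borel directed graph on a standard Borel space $V(D)$ whose underlying graph $\tilde{D}$ has finite Borel chromatic number $\chi_B(\tilde{D})<\infty$. Then there is a Borel quasi-kernel in $D$, i.e. a Borel set $M\subseteq V(D)$ that is independent in $\tilde{D}$ and satisfies $\rho(x,M)\leq 2$ for every $x\in V(D)$.
   Context: A directed graph $D$ consists of a vertex set $V(D)$ and an irreflexive relation $A(D)\subseteq V(D)\times V(D)$ of arcs; $x\to y$ means $(x,y)\in A(D)$. It is a Borel directed graph if $V(D)$ is a standard Borel space and $A(D)$ is a Borel subset of $V(D)\times V(D)$. The underlying (undirected) graph $\tilde{D}$ has the same vertices, with $x,y$ adjacent iff $(x,y)\in A(D)$ or $(y,x)\in A(D)$. $D$ is locally countable if every vertex has countably many neighbours in $\tilde{D}$. The Borel chromatic number $\chi_B(\tilde{D})$ is the least $k$ such that there is a Borel map $c:V(D)\to\{0,\dots,k-1\}$ with $c(x)\neq c(y)$ whenever $x,y$ are adjacent in $\tilde{D}$ ($\infty$ if no such finite $k$ exists). A set is independent if no two of its elements are adjacent in $\tilde{D}$. The directed distance $\rho(x,y)$ is the minimal length $k$ of a directed path $x=x_0\to x_1\to\cdots\to x_k=y$ (with $\rho(x,x)=0$ and $\rho(x,y)=\infty$ if there is no such path), and $\rho(x,A)=\inf_{y\in A}\rho(x,y)$. *)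

(* Defs.v *)
From mathcomp Require Import all_boot all_order all_algebra.
From mathcomp Require Import all_classical all_reals all_analysis.

Set Implicit Arguments.
Unset Strict Implicit.
Unset Printing Implicit Defensive.

Local Open Scope classical_set_scope.
Local Open Scope ring_scope.

(* A measurable space is given here by a carrier [V : Type] and its family
   [B : set (set V)] of measurable sets, and not by a [measurableType], because
   the latter is pointed whereas the empty space is a standard Borel space.  For
   the same reason completeness is stated without [completeType]. *)

Section StandardBorel.
Variable R : realType.

Definition complete_space (X : uniformType) :=
  forall F : set_system X, ProperFilter F -> cauchy F -> exists x : X, F --> x.

Definition separable_space (X : topologicalType) :=
  exists2 S : set X, countable S & dense S.

(* [(V, B)] is isomorphic, as a measurable space, to a Polish space with its
   Borel sets; in particular [B] is then a sigma-algebra. *)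
Definition standard_Borel (V : Type) (B : set (set V)) :=
  exists X : metricType R,
    [/\ complete_space X, separable_space X &
        exists2 f : V -> X, bijective f &
          forall A : set V, B A <-> <<s @open X >> (f @` A)].

End StandardBorel.

Definition product_sigma_algebra (V W : Type)
    (B : set (set V)) (C : set (set W)) : set (set (V * W)) :=
  <<s [set U `*` U' | U in B & U' in C] >>.

Record digraph (V : Type) := Digraph {
  arcs : set (V * V) ;
  arcs_irrefl : forall x, ~ arcs (x, x)
}.

Section Digraph.
Variables (V : Type) (D : digraph V).

Definition adjacent (x y : V) := arcs D (x, y) \/ arcs D (y, x).

Definition locally_countable := forall x, countable [set y | adjacent x y].

Definition independent (M : set V) :=
  forall x y, M x -> M y -> ~ adjacent x y.

Definition dipath (k : nat) (x y : V) :=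
  exists p : nat -> V,
    [/\ p 0%N = x, p k = y & forall i, (i < k)%N -> arcs D (p i, p i.+1)].

Section Distance.
Variable R : realType.

(* Both infima are over sets of natural numbers, possibly with +oo; the infimum
   of the empty set is +oo. *)
Definition didist (x y : V) : \bar R :=
  ereal_inf [set (k%:R)%:E | k in [set k : nat | dipath k x y]].

Definition didist_set (x : V) (M : set V) : \bar R :=
  ereal_inf [set didist x y | y in M].

End Distance.

Section Borel.
Variable B : set (set V).

Definition Borel_digraph := product_sigma_algebra B B (arcs D).

Definition Borel_coloring (k : nat) (c : V -> 'I_k) :=
  (forall U : set 'I_k, B (c @^-1` U)) /\
  (forall x y, adjacent x y -> c x <> c y).

Definition Borel_chromatic_number (R : realType) : \bar R :=
  ereal_inf [set (k%:R)%:E | k in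
    [set k : nat | exists c : V -> 'I_k, Borel_coloring c]].

Definition Borel_quasi_kernel (R : realType) (M : set V) :=
  [/\ B M, independent M & forall x, (didist_set R x M <= 2%:E)%E].

End Borel.
End Digraph.

(* Main.v *)
Require Import Defs.
From mathcomp Require Import all_boot all_order all_algebra.
From mathcomp Require Import all_classical all_reals all_analysis.
From mathcomp Require Import lra.

(* Split off a colour class [C]: a quasi-kernel [M'] of what remains after
   removing [C] and the in-neighbours of [C] extends to the quasi-kernel
   [M' `|` (C `\` in-neighbours of M')].  Everything thus reduces to showing
   that the in-neighbours of a Borel set form a Borel set, i.e. to the theorem
   of Lusin and Novikov that a Borel set with countable sections has a Borel
   projection.

   For that theorem, a Borel set [P] carries countable covers by cells such that
   a family of pairwise meeting cells of every level shrinks to a point of [P].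
   Let [g] be continuous and countable-to-one on [P].  Call a finite family [K]
   of subsets of [P] small if there are Borel sets [C i] containing [g @` K i]
   whose common part meets [g @` P] in a Borel set; the one-member family [P] is
   small iff [g @` P] is Borel.  A family that is not small can be refined so
   that every member lies in a cell of a prescribed level and is split into two
   members lying in disjoint cells, without becoming small.  Iterating this
   yields a Cantor set of points of [P], and [g] is constant on it because the
   closures of the sets [g @` K i] meet pairwise as long as the family is not
   small. *)

Set Implicit Arguments.
Unset Strict Implicit.
Unset Printing Implicit Defensive.

Import Order.TTheory GRing.Theory Num.Theory.

Local Open Scope classical_set_scope.
Local Open Scope ring_scope.

(** * Countable operations in a sigma-algebra *)

Section SigmaAlgebra.
Variables (T : Type) (S : set (set T)).
Hypothesis S_sigma : sigma_algebra setT S.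

Lemma sigma_setC A : S A -> S (~` A).
Proof. by case: S_sigma => _ SC _ /SC; rewrite setTD. Qed.

Lemma sigma_setT : S setT.
Proof. by case: S_sigma => S0 _ _; rewrite -setC0; exact: sigma_setC. Qed.

Lemma sigma_bigcup (I : countType) (D : set I) (F : I -> set T) :
  (forall i, D i -> S (F i)) -> S (\bigcup_(i in D) F i).
Proof.
move=> SF; case: S_sigma => S0 _ SU.
pose A n := if unpickle n is Some i then
  if `[< D i >] then F i else set0 else set0.
suff -> : \bigcup_(i in D) F i = \bigcup_n A n.
  apply: SU => n; rewrite /A; case: unpickle => // i.
  by case: asboolP => // /SF.
apply/seteqP; split=> x.
  by move=> [i Di Fix]; exists (pickle i) => //; rewrite /A pickleK asboolT.
move=> [n _]; rewrite /A; case: unpickle => // i.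
by case: asboolP => // Di Fix; exists i.
Qed.

Lemma sigma_bigcap (I : countType) (D : set I) (F : I -> set T) :
  (forall i, D i -> S (F i)) -> S (\bigcap_(i in D) F i).
Proof.
move=> SF; rewrite -[X in S X]setCK setC_bigcap.
by apply/sigma_setC/sigma_bigcup => i /SF/sigma_setC.
Qed.

Lemma sigma_forall (I : countType) (F : I -> set T) :
  (forall i, S (F i)) -> S [set x | forall i, F i x].
Proof.
move=> SF; rewrite (_ : mkset _ = \bigcap_i F i); first exact: sigma_bigcap.
by apply/seteqP; split=> [x Fx i _|x Fx i]; exact: Fx.
Qed.

Lemma sigma_setU A A' : S A -> S A' -> S (A `|` A').
Proof.
move=> SA SA'; rewrite -bigcup2inE.
by apply: sigma_bigcup => -[|[|[]]].
Qed.

Lemma sigma_setI A A' : S A -> S A' -> S (A `&` A').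
Proof.
move=> /sigma_setC SA /sigma_setC SA'.
by rewrite -[X in S X]setCK setCI; apply/sigma_setC/sigma_setU.
Qed.

Lemma sigma_setD A A' : S A -> S A' -> S (A `\` A').
Proof. by move=> SA /sigma_setC; exact: sigma_setI. Qed.

End SigmaAlgebra.

(** * Complete sequences of countable covers *)

Section CompleteCovers.
Variable T : topologicalType.

(* Frolik's complete sequences of countable covers, in the variant where the
   limit point is required to lie in every member of the family. *)
Definition complete_covers (J : Type) (P : set T) (B : nat -> J -> set T) :=
  [/\ forall n x, P x -> exists j, B n j x,
      forall n j, B n j `<=` P &
      forall C : nat -> set J,
        (forall n, C n !=set0) ->
        (forall n m j k, C n j -> C m k -> B n j `&` B m k !=set0) ->
        exists2 z, forall n j, C n j -> B n j z &
          forall U, nbhs z U ->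
            exists N, forall n j, (N <= n)%N -> C n j -> B n j `<=` U].

Definition completely_covered (P : set T) :=
  exists B : nat -> nat -> set T, complete_covers P B.

End CompleteCovers.

(** Balls of a quarter of the distance work, as the closure of each lies in the ball of twice the
    radius. Closures have to be disjoint because images are controlled below only up to closure. *)
Lemma metric_closure_separated (R : realType) (X : metricType R) (x y : X) :
  x <> y -> exists U V,
    [/\ nbhs x U, nbhs y V & closure U `&` closure V = set0].
Proof.
move=> /eqP; rewrite -mdist_gt0; set d := mdist x y => d0.
have d4 : 0 < d / 4 by rewrite divr_gt0.
exists (ball x (d / 4)), (ball y (d / 4)); split; [exact: nbhsx_ballx..|].
have clb z : closure (ball z (d / 4)) `<=` ball z (d / 2).
  have -> : d / 4 = (d / 2) / 2 by rewrite -mulrA -invfM -natrM.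
  by apply: subset_closure_half; rewrite divr_gt0.
rewrite -subset0 => z [/clb xz /clb/ball_sym zy].
by have := ball_triangle xz zy; rewrite -splitr ballEmdist /= ltxx.
Qed.

(** * Images under continuous countable-to-one maps *)

Section CountableToOneImage.
Variables (R : realType) (X : metricType R) (T : topologicalType).
Variables (P : set T) (B : nat -> nat -> set T) (g : T -> X).
Hypothesis P_covers : complete_covers P B.
Hypothesis g_continuous : continuous g.

Let Borel : set (set X) := <<s @open X >>.
Let E : set X := g @` P.
Let cell (c : nat * nat) : set T := B c.1 c.2.

Let Borel_sigma : sigma_algebra setT Borel.
Proof. exact: smallest_sigma_algebra. Qed.

Let Borel_closure A : Borel (closure A).
Proof.
rewrite -[closure A]setCK; apply: (sigma_setC Borel_sigma).
by apply: sub_sigma_algebra; exact/closed_openC/closed_closure.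
Qed.

Definition small (I : finType) (K : I -> set T) :=
  exists C : I -> set X,
    [/\ forall i, Borel (C i), forall i, g @` (K i) `<=` C i &
        Borel (E `&` [set x | forall i, C i x])].

(** A finite family admits only countably many choices [c] of cells, so witnesses of smallness for
    all of them can be glued by countable operations. *)
Lemma small_refine n (I : finType) (K : I -> set T) :
  (forall i, K i `<=` P) ->
  (forall c : {ffun I -> nat}, small (fun i => K i `&` B n (c i))) ->
  small K.
Proof.
move=> KP /choice[C smallC].
pose A i d := \bigcap_(c in [set c : {ffun I -> nat} | c i = d]) C c i.
have BA i d : Borel (A i d).
  by apply: (sigma_bigcap Borel_sigma) => c _; case: (smallC c).
exists (fun i => \bigcup_d A i d); split.
- by move=> i; apply: (sigma_bigcup Borel_sigma).
- move=> i _ [x Kx <-]; have [+ _ _] := P_covers.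
  move=> /(_ n x (KP _ _ Kx))[d Bx]; exists d => // c /= cid.
  by have [_ + _] := smallC c; apply; exists x => //; rewrite cid.
- rewrite [X in Borel X](_ : _ = \bigcup_(c : {ffun I -> nat})
    ([set x | forall i, A i (c i) x] `&` (E `&` [set x | forall i, C c i x]))).
    apply: (sigma_bigcup Borel_sigma) => c _; apply: (sigma_setI Borel_sigma).
      exact: (sigma_forall Borel_sigma).
    by case: (smallC c).
  apply/seteqP; split=> x.
    move=> [Ex]; move=> /(_ _)/cid2-/all_sig2[d _ dA].
    exists (finfun d) => //; split=> [i|]; first by rewrite ffunE; exact: dA.
    by split=> // i; apply: (dA i) => /=; rewrite ffunE.
  by move=> [c _ [Ax [Ex _]]]; split=> // i; exists (c i).
Qed.

Let disjoint_cells (I : finType)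
    (ab : {ffun I -> nat * nat} * {ffun I -> nat * nat}) :=
  forall i, cell (ab.1 i) `&` cell (ab.2 i) = set0.

(** For a point [x] of the image of [K i], either two disjoint cells [c] satisfy [A i c x], which is
    [N i], or such cells exist on every level and meet pairwise, which is [G i] and forces [x] into
    [E]. If [N i] holds for all [i], the disjoint pairs form some [ab], whose witnesses apply. *)
Lemma small_split (I : finType) (K : I -> set T) :
  (forall i, K i `<=` P) ->
  (forall ab, disjoint_cells ab -> small (fun ib : I * bool =>
     K ib.1 `&` cell (if ib.2 then ab.1 ib.1 else ab.2 ib.1))) ->
  small K.
Proof.
move=> KP smallK.
have /choice[C smallC] : forall ab, exists C : I * bool -> set X,
    disjoint_cells (I := I) ab ->
    [/\ forall i, Borel (C i),
        forall ib, g @` (K ib.1 `&`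
          cell (if ib.2 then ab.1 ib.1 else ab.2 ib.1)) `<=` C ib &
        Borel (E `&` [set x | forall i, C i x])].
  move=> ab; have [/smallK[C ?]|nd] := pselect (disjoint_cells ab).
    by exists C.
  by exists (fun=> set0) => /nd.
(* A Borel set containing the image of the part of [K i] in the cell [c]. The closure lets the
   continuity of [g] locate [x] when the cells shrink. *)
pose A i c := closure (g @` (K i `&` cell c)) `&`
  (\bigcap_(ab in [set ab | disjoint_cells ab /\ ab.1 i = c]) C ab (i, true)
  `&` \bigcap_(ab in [set ab | disjoint_cells ab /\ ab.2 i = c]) C ab (i, false)).
pose N i := \bigcup_(cc in [set cc : (nat * nat) * (nat * nat) |
  cell cc.1 `&` cell cc.2 = set0]) (A i cc.1 `&` A i cc.2).
pose G i := [set x | forall n, (\bigcup_d A i (n, d)) x] `\` N i.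
have BA i c : Borel (A i c).
  apply: (sigma_setI Borel_sigma) => //; apply: (sigma_setI Borel_sigma);
    by apply: (sigma_bigcap Borel_sigma) => ab /= [/smallC[]].
have BN i : Borel (N i).
  by apply: (sigma_bigcup Borel_sigma) => cc _; apply: (sigma_setI Borel_sigma).
have BG i : Borel (G i).
  apply: (sigma_setD Borel_sigma) => //; apply: (sigma_forall Borel_sigma) => n.
  exact: (sigma_bigcup Borel_sigma).
have KA i c x : K i x -> cell c x -> A i c (g x).
  move=> Kx cx; split; first by apply: subset_closure; exists x.
  by split=> ab [/smallC[_ + _] abc];
    [move=> /(_ (i, true))|move=> /(_ (i, false))]; apply; exists x => //=; rewrite abc.
(* The cells [c] with [A i c x] meet pairwise when [x] is outside [N i], so they
   shrink to a point above [x]. *)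
have GE i : G i `<=` E.
  move=> x [Ax Nx].
  have [_ BP /(_ (fun n d => A i (n, d) x))[]] := P_covers.
  - by move=> n; have [d _ Ad] := Ax n; exists d.
  - move=> n m j k Aj Ak; apply/set0P/eqP => jk0; apply: Nx.
    by exists ((n, j), (m, k)).
  move=> z Cz zU.
  have Pz : P z by have [d _ /Cz] := Ax 0%N; exact: BP.
  exists z => //; apply: contrapT.
  move=> /metric_closure_separated[U [V [gzU xV UV0]]].
  have [M] := zU _ (g_continuous gzU).
  have [d _ Ad] := Ax M; move=> /(_ M d (leqnn M) Ad) BU.
  have [clx _] := Ad.
  suff : (closure U `&` closure V) x by rewrite UV0.
  split; last by apply: subset_closure; exact: nbhs_singleton.
  by apply: closure_subset clx => _ [w [_ /BU ?] <-].
exists (fun i => N i `|` G i); split.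
- by move=> i; apply: (sigma_setU Borel_sigma).
- move=> i _ [x Kx <-]; have [|nN] := pselect (N i (g x)); first by left.
  right; split=> // n; have [+ _ _] := P_covers.
  by move=> /(_ n x (KP _ _ Kx))[d dx]; exists d => //; exact: KA.
- rewrite [X in Borel X](_ : _ =
    \bigcup_(ab in @disjoint_cells I)
      ([set x | forall i, (A i (ab.1 i) `&` A i (ab.2 i)) x] `&`
       (E `&` [set x | forall i, C ab i x])) `|`
    \bigcup_i (G i `&` [set x | forall j, (N j `|` G j) x])).
    apply: (sigma_setU Borel_sigma).
      apply: (sigma_bigcup Borel_sigma) => ab /smallC[_ _ BC].
      apply: (sigma_setI Borel_sigma) => //; apply: (sigma_forall Borel_sigma) => i.
      exact: (sigma_setI Borel_sigma).
    apply: (sigma_bigcup Borel_sigma) => i _; apply: (sigma_setI Borel_sigma) => //.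
    by apply: (sigma_forall Borel_sigma) => j; exact: (sigma_setU Borel_sigma).
  apply/seteqP; split=> x.
    move=> [Ex NGx]; have [[i Gx]|nG] := pselect (exists i, G i x).
      by right; exists i.
    have Nx i : N i x by have [//|Gx] := NGx i; case: nG; exists i.
    left; move: Nx => /(_ _)/cid2-/all_sig2[cc cc0 ccA].
    pose ab := (finfun (fst \o cc), finfun (snd \o cc)).
    have abd : disjoint_cells ab by move=> i; rewrite /= !ffunE; exact: cc0.
    exists ab => //; split=> [i|]; first by rewrite !ffunE; exact: ccA.
    split=> // -[i b]; have [[_ [A1 _]] [_ [_ A2]]] := ccA i.
    by case: b; [apply: A1|apply: A2]; split=> //=; rewrite ffunE.
  move=> [[ab abd [Ax [Ex _]]]|[i _ [/GE Ex NGx]]]; split=> // i.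
  by left; exists (ab.1 i, ab.2 i) => //; exact: abd.
Qed.

(** Disjoint closures would be Borel witnesses with empty common part. The case [i = j] says that
    [K i] is non-empty. *)
Lemma not_small_closure (I : finType) (K : I -> set T) i j :
  ~ small K -> closure (g @` K i) `&` closure (g @` K j) !=set0.
Proof.
move=> bigK; apply/set0P/eqP => ij0; apply: bigK.
exists (fun i => closure (g @` K i)); split=> //.
  by move=> k; exact: subset_closure.
rewrite [X in Borel X](_ : _ = set0); first by case: Borel_sigma.
rewrite -subset0 => x [_ clx].
by have : (closure (g @` K i) `&` closure (g @` K j)) x; [|rewrite ij0].
Qed.


Lemma not_small_step n (I : finType) (K : I -> set T) :
  (forall i, K i `<=` P) -> ~ small K ->
  exists K' : I * bool -> set T,
    [/\ ~ small K', forall ib, K' ib `<=` K ib.1,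
        forall ib, exists d, K' ib `<=` B n d &
        forall i, exists c c', [/\ cell c `&` cell c' = set0,
          K' (i, true) `<=` cell c & K' (i, false) `<=` cell c']].
Proof.
move=> KP /(contra_not (small_split KP)) /existsNP[ab /not_implyP[abd]].
set K1 := (fun ib : I * bool => _) => big1.
have K1P ib : K1 ib `<=` P by move=> x [/KP].
have /existsNP[c big2] := contra_not (@small_refine n _ _ K1P) big1.
exists (fun ib => K1 ib `&` B n (c ib)); split=> //.
- by move=> ib x [[]].
- by move=> ib; exists (c ib) => x [].
- by move=> i; exists (ab.1 i), (ab.2 i); split=> // x [[]].
Qed.

(** Binary words of length [n] with the last letter outermost, so that level [n.+1] is the index
    type [I * bool] produced by [not_small_step]. *)
Fixpoint tree_level n : finType :=
  if n is m.+1 then (tree_level m * bool)%type : finType else unit.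

Fixpoint branch (s : nat -> bool) n : tree_level n :=
  if n is m.+1 then (branch s m, s m) else tt.

(** Dependent choice from the one-member family [P]. As the root is all of [P], it is the members of
    level [n.+1] that lie in cells of level [n]. *)
Lemma Cantor_tree : ~ Borel E ->
  exists K : forall n, tree_level n -> set T,
    [/\ forall n, ~ small (K n),
        forall n (i : tree_level n) b, K n.+1 (i, b) `<=` K n i,
        forall n (i : tree_level n) b, exists d, K n.+1 (i, b) `<=` B n d &
        forall n (i : tree_level n), exists c c', [/\ cell c `&` cell c' = set0,
          K n.+1 (i, true) `<=` cell c & K n.+1 (i, false) `<=` cell c']].
Proof.
move=> nBE.
pose st n := {K : tree_level n -> set T | (forall i, K i `<=` P) /\ ~ small K}.
have big0 : ~ small (fun _ : tree_level 0 => P).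
  move=> [C [_ EC]]; rewrite (_ : E `&` _ = E) //.
  by apply/seteqP; split=> [x []|x Ex] //; split=> // i; exact: EC Ex.
pose rel n (S : st n) (S' : st n.+1) :=
  [/\ forall i b, sval S' (i, b) `<=` sval S i,
      forall i b, exists d, sval S' (i, b) `<=` B n d &
      forall i, exists c c', [/\ cell c `&` cell c' = set0,
        sval S' (i, true) `<=` cell c & sval S' (i, false) `<=` cell c']].
have step n (S : st n) : exists S' : st n.+1, rel n S S'.
  case: S => K [KP bigK].
  have [K' [bigK' KK' K'B K's]] := @not_small_step n _ _ KP bigK.
  have K'P ib : K' ib `<=` P by move=> x /KK'/KP.
  by exists (exist _ K' (conj K'P bigK')); split.
pose f n (S : st n) := sval (cid (step n S)).
pose F := nat_rect st (exist _ _ (conj (fun=> @subset_refl _ P) big0)) f.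
have Frel n : rel n (F n) (F n.+1) := svalP (cid (step n (F n))).
exists (fun n => sval (F n)); split=> n; first by case: (svalP (F n)).
- by case: (Frel n).
- by case: (Frel n).
- by case: (Frel n).
Qed.

Lemma uncountable_fiber : ~ Borel E ->
  exists z : (nat -> bool) -> T,
    [/\ injective z, forall s, P (z s) & forall s t, g (z s) = g (z t)].
Proof.
move=> /Cantor_tree[K [bigK KS KB Ksplit]].
(* All cells containing some member along [s], whether obtained by refining or by splitting. They
   meet pairwise because these members are nested and non-empty. *)
pose C s n d := exists m, K m (branch s m) `<=` B n d.
have Kmono s m n : (m <= n)%N -> K n (branch s n) `<=` K m (branch s m).
  move=> /subnK <-; elim: (n - m)%N => // k IH x.
  by rewrite addSn => /KS/IH.
have K0 s m : K m (branch s m) !=set0.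
  apply/set0P/eqP => Km0.
  have := not_small_closure (branch s m) (branch s m) (bigK m).
  by rewrite Km0 image_set0 closure0 setI0 => -[].
have [_ BP Bcomplete] := P_covers.
have /choice[z zP] : forall s, exists z,
    (forall n d, C s n d -> B n d z) /\
    forall U, nbhs z U ->
      exists N, forall n j, (N <= n)%N -> C s n j -> B n j `<=` U.
  move=> s; have [|n m j k [n' Kj] [m' Kk]|z Cz zU] := Bcomplete (C s).
  - by move=> n; have [d Kd] := KB n (branch s n) (s n); exists d, n.+1.
  - have [x Kx] := K0 s (maxn n' m').
    by exists x; split; [apply/Kj/(Kmono _ _ _ _ _ Kx)/leq_maxl
                        |apply/Kk/(Kmono _ _ _ _ _ Kx)/leq_maxr].
  - by exists z; split.
exists z; split.
- move=> s t zst; apply: contrapT => nst.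
  (* At the first difference the two branches still share their node, whose split puts [z s = z t]
     into two disjoint cells. *)
  have /ex_minnP[n nP nmin] : exists n, s n != t n.
    apply: contrapT => /forallNP st; apply/nst/funext => n.
    by have /negP/negPn/eqP := st n.
  have brn m : (m <= n)%N -> branch s m = branch t m.
    elim: m => //= m IH mn; rewrite IH ?(ltnW mn)//; congr pair.
    by apply/eqP; apply: contraTT mn => /nmin; rewrite -leqNgt.
  have [c [c' [cc0 Kc Kc']]] := Ksplit n (branch s n).
  suff : (cell c `&` cell c') (z s) by rewrite cc0.
  move: nP; case sn: (s n); case tn: (t n) => // _; split.
  + by apply: (zP s).1; exists n.+1 => /=; rewrite sn.
  + by rewrite zst; apply: (zP t).1; exists n.+1 => /=; rewrite tn -brn.
  + by rewrite zst; apply: (zP t).1; exists n.+1 => /=; rewrite tn -brn.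
  + by apply: (zP s).1; exists n.+1 => /=; rewrite sn.
- move=> s; have [d Kd] := KB 0%N (branch s 0) (s 0%N).
  by apply: (BP 0%N d); apply: (zP s).1; exists 1%N.
- move=> s t; apply: contrapT => /metric_closure_separated[U [V [sU tV UV0]]].
  have [N NP] := (zP s).2 _ (g_continuous sU).
  have [M MP] := (zP t).2 _ (g_continuous tV).
  pose n := maxn N M.
  have [d Kd] := KB n (branch s n) (s n).
  have [d' Kd'] := KB n (branch t n) (t n).
  have [x [sx tx]] :=
    not_small_closure (branch s n.+1) (branch t n.+1) (bigK n.+1).
  suff : (closure U `&` closure V) x by rewrite UV0.
  split.
    apply: closure_subset sx => _ [w /Kd Kw <-].
    by apply: (NP n d _ _ _ Kw); [exact: leq_maxl|exists n.+1].
  apply: closure_subset tx => _ [w /Kd' Kw <-].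
  by apply: (MP n d' _ _ _ Kw); [exact: leq_maxr|exists n.+1].
Qed.

Theorem Borel_countable_to_one_image :
  (forall x, countable (P `&` g @^-1` [set x])) -> <<s @open X >> (g @` P).
Proof.
move=> countP; apply: contrapT => /uncountable_fiber[z [zinj zP zg]].
have /countable_injP[h hinj] := countP (g (z (fun=> true))).
have hz s t : h (z s) = h (z t) -> s = t.
  by move=> /hinj zst; apply/zinj/zst; rewrite inE; split=> //; exact: zg.
(* Cantor's diagonal sequence: since [h] is injective along [z], the value of [d] at [h (z d)]
   contradicts its definition. *)
pose d n := `[< ~ exists2 s : nat -> bool, h (z s) = n & s n >].
have [dn|/contrapT[s /hz ->]] :=
  asboolP (~ exists2 s, h (z s) = h (z d) & s (h (z d))).
  by apply: (dn); exists d => //; exact/asboolT.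
by move=> dn; move: (dn) => /asboolP; apply; exists d.
Qed.

End CountableToOneImage.

(** * Permanence properties of completely covered sets *)

(** Cells are renumbered by [pickle]. A number coding nothing gets the empty cell, which no pairwise
    meeting family contains, as each of its cells also meets itself. *)
Lemma complete_covers_countType (T : topologicalType) (J : countType)
    (P : set T) (B : nat -> J -> set T) :
  complete_covers P B -> completely_covered P.
Proof.
move=> [Bcov BP Bcomplete].
pose B' n m := if unpickle m is Some j then B n j else set0.
exists B'; split.
- by move=> n x /(Bcov n)[j Bx]; exists (pickle j); rewrite /B' pickleK.
- by move=> n m; rewrite /B'; case: unpickle => [j|] //; exact: BP.
move=> C C0 CI.
have CS n m : C n m -> exists j : J, unpickle m = Some j.
  move=> Cm; have [x [+ _]] := CI _ _ _ _ Cm Cm.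
  by rewrite /B'; case: unpickle => // j _; exists j.
pose C' n (j : J) := exists2 m, C n m & unpickle m = Some j.
have [| |z Cz zU] := Bcomplete C'.
- by move=> n; have [m Cm] := C0 n; have [j mj] := CS _ _ Cm; exists j, m.
- move=> n m j k [n' Cj n'j] [m' Ck m'k]; have := CI _ _ _ _ Cj Ck.
  by rewrite /B' n'j m'k.
exists z.
  move=> n m Cm; have [j mj] := CS _ _ Cm.
  by rewrite /B' mj; apply: Cz; exists m.
move=> U /zU[N NP]; exists N => n m Nn Cm; have [j mj] := CS _ _ Cm.
by rewrite /B' mj; apply: NP => //; exists m.
Qed.

Lemma completely_covered0 (T : topologicalType) : completely_covered (@set0 T).
Proof.
exists (fun _ _ => set0); split=> [n x []|n j x []|C C0 CI]; have [i Ci] := C0 0%N.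
by have [x []] := CI _ _ _ _ Ci Ci.
Qed.

(** A cell of level [n] prescribes a cell of level [n - k] of [P k] for each [k <= n]: finite data,
    hence countably many cells, and yet every level of every [P k] occurs. *)
Lemma completely_covered_bigcap (T : topologicalType) (P : nat -> set T) :
  hausdorff_space T -> (forall k, completely_covered (P k)) ->
  completely_covered (\bigcap_k P k).
Proof.
move=> T2 /choice[B Bcc].
pose B' n (s : seq nat) := [set x | (\bigcap_k P k) x /\
  forall k, (k <= n)%N -> B k (n - k)%N (nth 0%N s k) x].
apply: (@complete_covers_countType _ _ _ B'); split.
- move=> n x Px.
  have /choice[i iP] : forall k, exists i, B k (n - k)%N i x.
    by move=> k; have [+ _ _] := Bcc k; apply; exact: Px.
  exists (mkseq i n.+1); split=> // k kn; rewrite nth_mkseq ?ltnS//; exact: iP.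
- by move=> n s x [].
move=> C C0 CI.
pose C' k m i := exists2 s, C (k + m)%N s & nth 0%N s k = i.
have CP k n s : (k <= n)%N -> C n s -> C' k (n - k)%N (nth 0%N s k).
  by move=> kn Cs; exists s => //; rewrite subnKC.
have /choice[z zP] : forall k, exists z,
    (forall n i, C' k n i -> B k n i z) /\
    forall U, nbhs z U ->
      exists N, forall n j, (N <= n)%N -> C' k n j -> B k n j `<=` U.
  move=> k; have [_ _ /(_ (C' k))[]] := Bcc k.
  - by move=> n; have [s Cs] := C0 (k + n)%N; exists (nth 0%N s k), s.
  - move=> n m _ _ [s Cs <-] [t Ct <-].
    have [x [[_ sx] [_ tx]]] := CI _ _ _ _ Cs Ct.
    by exists x; have := sx k (leq_addr _ _); have := tx k (leq_addr _ _);
      rewrite !addKn.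
  - by move=> z Cz zU; exists z; split.
(* A single cell of high level has a point, and this point is close to both limits; the Hausdorff
   property then identifies them. *)
have zE k : z 0%N = z k.
  apply: T2 => U V /(zP 0%N).2[N NP] /(zP k).2[M MP].
  pose n := (k + maxn N M)%N; have [s Cs] := C0 n.
  have [x [[_ sx] _]] := CI _ _ _ _ Cs Cs.
  exists x; split.
    apply: (NP n (nth 0%N s 0)); last by have := sx 0%N isT; rewrite subn0.
      by rewrite (leq_trans (leq_maxl N M)) ?leq_addl.
    by have := CP 0%N n s isT Cs; rewrite subn0.
  apply: (MP (n - k)%N (nth 0%N s k)); last by apply: sx; exact: leq_addr.
    by rewrite addKn leq_maxr.
  by apply: CP => //; exact: leq_addr.
have zB k n i : C' k n i -> B k n i (z 0%N) by rewrite (zE k); exact: (zP k).1.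
exists (z 0%N).
  move=> n s Cs; split=> [k _|k kn]; last by apply: zB; exact: CP.
  have [s' Cs'] := C0 k; have [_ + _] := Bcc k.
  by apply; apply: zB; apply: (CP k k s').
move=> U /(zP 0%N).2[N NP]; exists N => n s Nn Cs x [_ sx].
by apply: (NP n (nth 0%N s 0)); [|have := CP 0%N n s isT Cs|have := sx 0%N isT];
  rewrite ?subn0.
Qed.

(** Cells over different [k] are disjoint, so a pairwise meeting family stays within one [P k]. *)
Lemma completely_covered_bigcup (T : topologicalType) (P : nat -> set T) :
  trivIset setT P -> (forall k, completely_covered (P k)) ->
  completely_covered (\bigcup_k P k).
Proof.
move=> tP /choice[B Bcc].
apply: (@complete_covers_countType _ _ _ (fun n ki => B ki.1 n ki.2)); split.
- move=> n x [k _ Px]; have [/(_ n x Px)[i ix] _ _] := Bcc k.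
  by exists (k, i).
- move=> n [k i] x /= ix; exists k => //.
  by have [_ + _] := Bcc k; apply; exact: ix.
move=> C C0 CI; have [[k i0] Ck] := C0 0%N.
have Ek n l i : C n (l, i) -> l = k.
  move=> Cl; have [x [/= lx kx]] := CI _ _ _ _ Cl Ck.
  apply: (tP _ _ I I); exists x; split.
    by have [_ + _] := Bcc l; apply; exact: lx.
  by have [_ + _] := Bcc k; apply; exact: kx.
have [_ _ /(_ (fun n i => C n (k, i)))[]] := Bcc k.
- by move=> n; have [[l i] Cl] := C0 n; exists i; rewrite -(Ek _ _ _ Cl).
- by move=> n m i j Ci Cj; have := CI _ _ _ _ Ci Cj.
move=> z Cz zU; exists z.
  by move=> n [l i] Cl; move: (Cl); rewrite (Ek _ _ _ Cl); exact: Cz.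
move=> U /zU[N NP]; exists N => n [l i] Nn Cl; move: (Cl).
by rewrite (Ek _ _ _ Cl); exact: NP.
Qed.

(** The sides of pairwise meeting rectangles meet pairwise, so limits are found coordinatewise. *)
Lemma completely_coveredX (T T' : topologicalType) (P : set T) (P' : set T') :
  completely_covered P -> completely_covered P' ->
  completely_covered (P `*` P').
Proof.
move=> [B [Bcov BP Bcomplete]] [B' [Bcov' BP' Bcomplete']].
apply: (@complete_covers_countType _ _ _ (fun n ij => B n ij.1 `*` B' n ij.2)).
split.
- move=> n [x y] [/(Bcov n)[i ix] /(Bcov' n)[j jy]].
  by exists (i, j).
- by move=> n [i j] [x y] [/BP ? /BP' ?].
move=> C C0 CI.
have [| |z Cz zU] := Bcomplete (fun n i => exists j, C n (i, j)).
- by move=> n; have [[i j] Cij] := C0 n; exists i, j.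
- move=> n m i k [j Cij] [l Ckl].
  by have [[x y] [[/= ? _] [/= ? _]]] := CI _ _ _ _ Cij Ckl; exists x.
have [| |z' Cz' zU'] := Bcomplete' (fun n j => exists i, C n (i, j)).
- by move=> n; have [[i j] Cij] := C0 n; exists j, i.
- move=> n m j l [i Cij] [k Ckl].
  by have [[x y] [[/= _ ?] [/= _ ?]]] := CI _ _ _ _ Cij Ckl; exists y.
exists (z, z').
  by move=> n [i j] Cij; split; [apply: Cz; exists j|apply: Cz'; exists i].
move=> U [[V V'] /= [/zU[N NP] /zU'[M MP]] VU]; exists (maxn N M) => n [i j].
rewrite geq_max => /andP[Nn Mn] Cij [x y] [/= ix jy]; apply: VU; split=> /=.
  by apply: (NP n i) => //; exists j.
by apply: (MP n j) => //; exists i.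
Qed.

(** Treating a set and its complement together makes complementation trivial. A union is first made
    disjoint, each piece being an intersection of covered sets. *)
Lemma completely_covered_sigma_algebra (T : topologicalType) :
  hausdorff_space T -> completely_covered (@setT T) ->
  sigma_algebra setT
    [set P : set T | completely_covered P /\ completely_covered (~` P)].
Proof.
move=> T2 ccT; split=> /=.
- by rewrite setC0; split=> //; exact: completely_covered0.
- by move=> A [? ?]; rewrite setTD setCK.
move=> A ccA; split; last first.
  rewrite setC_bigcup; apply: completely_covered_bigcap => // k.
  by case: (ccA k).
rewrite seqDU_bigcup_eq; apply: completely_covered_bigcup.
  exact: trivIset_seqDU.
(* The finite intersection is padded: every index [k >= n] contributes [A n]. *)
move=> n; rewrite (_ : seqDU A n =
    \bigcap_k (if (k < n)%N then ~` A k else A n)).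
  apply: completely_covered_bigcap => // k.
  by case: ifP => _; [case: (ccA k)|case: (ccA n)].
apply/seteqP; split=> x.
  move=> [Ax nAx] k _; case: ifPn => // kn Akx; apply: nAx.
  by rewrite -bigcup_mkord; exists k.
move=> Ax; split; first by have := Ax n I; rewrite ltnn.
by rewrite -bigcup_mkord => -[k /= kn]; have := Ax k I; rewrite kn.
Qed.

(** * Locally closed sets in complete separable metric spaces *)

Section LocallyClosed.
Variables (R : realType) (X : metricType R).

Let r (n : nat) : R := n.+1%:R^-1.

Let r_gt0 n : 0 < r n. Proof. by rewrite invr_gt0. Qed.

Let r_le m n : (m <= n)%N -> r n <= r m.
Proof. by move=> mn; rewrite lef_pV2 ?posrE// ler_nat ltnS. Qed.

Let r_small (e : R) : 0 < e -> exists n, 4 * r n <= e.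
Proof.
move=> e0; have e4 : 0 < e / 4 by rewrite divr_gt0.
have [n _ /(_ n (leqnn n))] := near_infty_natSinv_lt (PosNum e4).
by move=> /= /ltW rn; exists n; rewrite mulrC -ler_pdivlMr.
Qed.

Let closed_ball_sub (x : X) m n : (n <= m)%N ->
  closed_ball x (r m) `<=` ball x (2 * r n).
Proof.
move=> nm y; have -> : r m = (2 * r m) / 2 by rewrite mulrC mulKf.
move=> /subset_closure_half; rewrite mulr_gt0// => /(_ isT).
by apply: le_ball; rewrite ler_pM2l// r_le.
Qed.

(** The cells are the traces on [Q] of small closed balls inside [O] with centres in [S]. When such
    balls meet pairwise and shrink, their centres form a Cauchy sequence; closedness keeps its limit
    in [Q] and in the balls, hence in [O]. *)
Lemma completely_covered_locally_closed (Q O : set X) :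
  complete_space X -> separable_space X -> closed Q -> open O ->
  completely_covered (Q `&` O).
Proof.
move=> Xcomplete [S /countable_injP[h hinj] Sdense] Qclosed Oopen.
(* The centre is coded by its number [k] under [h], so [k] and [m] determine at most one ball. *)
pose center k m x := [/\ S x, h x = k & closed_ball x (r m) `<=` O].
pose B n (km : nat * nat) := [set y | [/\ Q y, (n <= km.2)%N &
  exists2 x, center km.1 km.2 x & closed_ball x (r km.2) y]].
have center_uniq k m x x' : center k m x -> center k m x' -> x = x'.
  by move=> [Sx <- _] [Sx' /esym hx _]; apply: hinj => //; rewrite inE.
apply: (@complete_covers_countType _ _ _ B); split.
- move=> n y [Qy Oy].
  have [e e0 yeO] : exists2 e : R, 0 < e & ball y e `<=` O.
    by apply/nbhs_ballP; exact: open_nbhs_nbhs.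
  (* The closed ball chosen below lies within [3 * r m] of [y], which [4 * r m0] bounds. *)
  have [m0 m0e] := r_small e0; pose m := maxn n m0.
  have [x [yx Sx]] : (interior (ball y (r m)) `&` S) !=set0.
    apply: Sdense; last exact: open_interior.
    by exists y; exact: nbhsx_ballx.
  have {}yx := interior_subset yx.
  exists (h x, m); split=> //=; first exact: leq_maxl.
  exists x; last by apply: subset_closed_ball; exact: ball_sym.
  split=> // w /(closed_ball_sub (leqnn m)) xw; apply: yeO.
  apply: le_ball (ball_triangle yx xw); apply: le_trans m0e.
  have := r_le (leq_maxr n m0); rewrite -/m; have := r_gt0 m.
  by move: (r m) (r m0) => a b; lra.
- by move=> n [k m] y [Qy /= nm [x [_ _ xO] /xO]].
move=> C C0 CI.
have /choice[j jC] : forall n, exists j, C n j by move=> n; exact: C0.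
have /choice[x xP] : forall n, exists x,
    center (j n).1 (j n).2 x /\ (n <= (j n).2)%N.
  move=> n; have [y [[_ nj [x jx _]] _]] := CI _ _ _ _ (jC n) (jC n).
  by exists x.
have Bball n y : B n (j n) y -> ball (x n) (2 * r n) y.
  move=> [_ nm [x' /(center_uniq _ _ _ _ (xP n).1) <-]].
  exact: closed_ball_sub.
have [|z xz] := Xcomplete (x @ \oo) _.
  apply: cauchy_exP => e /r_small[N Ne]; exists (x N), N => // n /= Nn.
  have [p [Np np]] := CI _ _ _ _ (jC N) (jC n).
  apply: le_ball (ball_triangle (Bball _ _ Np) (ball_sym (Bball _ _ np))).
  apply: le_trans Ne; rewrite -mulrDr -[4]/((2 * 2)%:R) natrM -mulrA ler_pM2l//.
  by rewrite mulr_natl mulr2n lerD2l r_le.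
(* Any cell of the family meets the chosen cells of all high levels, which shrink to [z]. So [z] is
   in its closure, hence in [Q] and in its closed ball. *)
have Cz n i : C n i -> B n i z.
  move=> Ci; have [y0 [[_ ni [a ia _]] _]] := CI _ _ _ _ Ci Ci.
  have Bsub : B n i `<=` Q `&` closed_ball a (r i.2).
    by move=> y [Qy _ [a' /(center_uniq _ _ _ _ ia) <-]].
  suff /(closure_subset Bsub) : closure (B n i) z.
    have /closure_id <- : closed (Q `&` closed_ball a (r i.2)).
      by apply: closedI => //; exact: closed_ball_closed.
    by move=> [Qz az]; split=> //; exists a.
  move=> U /nbhs_ballP[e /= e0 eU].
  have e2 : 0 < e / 2 by rewrite divr_gt0.
  have [N Ne] := r_small e2.
  have [M _ Mz] := xz _ (nbhsx_ballx z _ e2).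
  pose k := maxn N M.
  have [p [ip kp]] := CI _ _ _ _ Ci (jC k).
  exists p; split=> //; apply: eU; rewrite [e]splitr.
  apply: ball_triangle (Mz k (leq_maxr _ _)) _.
  apply: le_ball (Bball _ _ kp); apply: le_trans Ne.
  have := r_le (leq_maxl N M); rewrite -/k; have := r_gt0 k.
  by move: (r k) (r N) => s t; lra.
exists z => // U /nbhs_ballP[e /= /r_small[N Ne] eU].
exists N => n i Nn Ci y iy.
apply: eU; have [_ ni [a ia az]] := Cz _ _ Ci.
have [_ _ [a' /(center_uniq _ _ _ _ ia) <- ay]] := iy.
have Ni := leq_trans Nn ni.
have za := ball_sym (closed_ball_sub Ni az).
apply: le_ball (ball_triangle za (closed_ball_sub Ni ay)).
by rewrite -mulrDl -natrD.
Qed.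

End LocallyClosed.

(** * Borel sets in Polish spaces and their projections *)

Section Polish.
Variables (R : realType) (X : metricType R).
Hypotheses (X_complete : complete_space X) (X_separable : separable_space X).

Let ccX : completely_covered [set: X].
Proof.
rewrite -[setT]setTI; apply: completely_covered_locally_closed => //.
exact: openT.
Qed.

Let both_covered (T : topologicalType) : set (set T) :=
  [set A | completely_covered A /\ completely_covered (~` A)].

Lemma Borel_completely_covered (A : set X) :
  <<s @open X >> A -> completely_covered A /\ completely_covered (~` A).
Proof.
move: A; apply: (@smallest_sub _ _ _ (@both_covered X)).
  by apply: completely_covered_sigma_algebra => //; exact: metric_hausdorff.
move=> O Oopen; split.
  by rewrite -(setTI O); apply: completely_covered_locally_closed.
rewrite -(setIT (~` O)); apply: completely_covered_locally_closed => //.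
  exact: open_closedC.
exact: openT.
Qed.

Lemma Borel_prod_completely_covered (A : set (X * X)) :
  product_sigma_algebra <<s @open X >> <<s @open X >> A ->
  completely_covered A.
Proof.
have XX2 : hausdorff_space (X * X)%type.
  move=> [a b] [c d] abcd.
  congr pair; apply: (@metric_hausdorff R X) => U V xU yV.
    have [||[u v] []] := abcd (fst @^-1` U) (fst @^-1` V); last by exists u.
    + exact: (@cvg_fst _ _ (nbhs a) (nbhs b) _ _ xU).
    + exact: (@cvg_fst _ _ (nbhs c) (nbhs d) _ _ yV).
  have [||[u v] []] := abcd (snd @^-1` U) (snd @^-1` V); last by exists v.
  + exact: (@cvg_snd _ _ (nbhs a) (nbhs b) _ _ xU).
  + exact: (@cvg_snd _ _ (nbhs c) (nbhs d) _ _ yV).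
have ccXX : completely_covered [set: X * X].
  by rewrite -setXTT; exact: completely_coveredX.
have GS := completely_covered_sigma_algebra XX2 ccXX.
suff : product_sigma_algebra <<s @open X >> <<s @open X >> `<=`
    @both_covered (X * X)%type.
  by move=> sub /sub[].
apply: smallest_sub => // _ [U UB [U' UB' <-]].
have [ccU ccCU] := Borel_completely_covered UB.
have [ccU' ccCU'] := Borel_completely_covered UB'.
(* Cylinders, unlike rectangles, have complements of the same form. *)
rewrite (_ : U `*` U' = (U `*` setT) `&` (setT `*` U')); last first.
  by apply/seteqP; split=> [[x y] []|[x y] [[? _] [_ ?]]].
apply: (sigma_setI GS); split; try exact: completely_coveredX.
  rewrite (_ : ~` _ = ~` U `*` setT); first exact: completely_coveredX.
  by apply/seteqP; split=> [[x y] nU|[x y] [nU _] []//]; split=> // Ux; apply: nU.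
rewrite (_ : ~` _ = setT `*` ~` U'); first exact: completely_coveredX.
by apply/seteqP; split=> [[x y] nU|[x y] [_ nU] []//]; split=> // Ux; apply: nU.
Qed.

(** The projection [fst] is continuous, and its fibres in [A] are copies of the sections. *)
Lemma Borel_countable_sections_projection (A : set (X * X)) :
  product_sigma_algebra <<s @open X >> <<s @open X >> A ->
  (forall x, countable [set y | A (x, y)]) -> <<s @open X >> (fst @` A).
Proof.
move=> /Borel_prod_completely_covered[B AB] Ac.
apply: (Borel_countable_to_one_image AB) => [[a b]|x]; first exact: cvg_fst.
have /countable_injP[h hinj] := Ac x.
apply/countable_injP; exists (h \o snd) => -[a b] [c d].
rewrite !inE => -[Aab /= ax] [Acd /= cx] /=; rewrite ax cx in Aab Acd *.
by move=> /hinj; rewrite !inE => ->.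
Qed.

End Polish.

(** * In-neighbours of Borel sets *)

Section InNeighbours.
Variables (R : realType) (V : Type) (B : set (set V)) (D : digraph V).
Hypothesis B_standard : standard_Borel R B.

Lemma standard_Borel_sigma_algebra : sigma_algebra setT B.
Proof.
have [X [_ _ [f [h fK hK] Bf]]] := B_standard.
have [S0 SC SU] := @smallest_sigma_algebra X setT open.
split; first by apply/Bf; rewrite image_set0.
- move=> A /Bf/SC; rewrite setTD => SA; apply/Bf.
  rewrite (_ : f @` _ = ~` (f @` A)) //.
  apply/seteqP; split=> [_ [x [_ nAx] <-] [y Ay /(can_inj fK) yx]|x nAx].
    by apply: nAx; rewrite -yx.
  by exists (h x); rewrite ?hK//; split=> // Ax; apply: nAx; exists (h x).
- by move=> A BA; apply/Bf; rewrite image_bigcup; apply: SU => n; exact/Bf.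
Qed.

Hypothesis D_Borel : Borel_digraph D B.
Hypothesis D_locally_countable : locally_countable D.

Definition in_neighbours (A : set V) :=
  [set x | exists2 y, A y & arcs D (x, y)].

(** These in-neighbours are the projection of the set of arcs ending in [A], which has countable
    sections by local countability. The isomorphism moves this set to the Polish space. *)
Lemma Borel_in_neighbours (A : set V) : B A -> B (in_neighbours A).
Proof.
have [X [Xcomplete Xseparable [f [h fK hK] Bf]]] := B_standard.
have fE (U : set V) : f @` U = h @^-1` U.
  apply/seteqP; split=> [_ [x Ux <-]|x Ux]; first by rewrite /= fK.
  by exists (h x).
move=> BA; apply/Bf.
pose hh (p : X * X) := (h p.1, h p.2).
pose S := product_sigma_algebra <<s @open X >> <<s @open X >>.
have S_sigma : sigma_algebra setT S by exact: smallest_sigma_algebra.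
have hhS (U : set (V * V)) : product_sigma_algebra B B U -> S (hh @^-1` U).
  move: U; apply: (@smallest_sub _ _ _ [set U | S (hh @^-1` U)]).
    have [S0 SC SU] := S_sigma; split=> /=; first by rewrite preimage_set0.
    - by move=> U SU'; rewrite setTD preimage_setC -setTD; exact: SC.
    - by move=> F SF; rewrite preimage_bigcup; exact: SU.
  move=> _ [U BU [U' BU' <-]]; apply: sub_sigma_algebra.
  by exists (f @` U); [exact/Bf|exists (f @` U'); [exact/Bf|rewrite !fE]].
have BT : B setT := sigma_setT standard_Borel_sigma_algebra.
have SP : S (hh @^-1` arcs D `&` hh @^-1` (setT `*` A)).
  by apply: (sigma_setI S_sigma); apply: hhS => //;
    apply: sub_sigma_algebra; exists setT => //; exists A.
rewrite (_ : f @` _ = fst @` (hh @^-1` arcs D `&` hh @^-1` (setT `*` A))).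
  apply: Borel_countable_sections_projection => // x.
  have /countable_injP[k kinj] := D_locally_countable (h x).
  apply/countable_injP; exists (k \o h) => a b.
  rewrite !inE => -[Da _] [Db _] /kinj ab; apply: (can_inj hK); apply: ab;
  by rewrite inE; left.
rewrite fE; apply/seteqP; split=> [x [y Ay xy]|_ [[x y] [xy [_ Ay]] <-]].
  by exists (x, f y) => //; split; rewrite /hh /= fK.
by exists (h y).
Qed.

End InNeighbours.

(** * Induction on the number of colours *)

Section QuasiKernel.
Variables (V : Type) (B : set (set V)) (D : digraph V).
Hypothesis B_sigma : sigma_algebra setT B.
Hypothesis B_in : forall A, B A -> B (in_neighbours D A).
Variable c : V -> nat.
Hypothesis B_c : forall k, B [set x | c x = k].
Hypothesis c_proper : forall x y, arcs D (x, y) -> c x <> c y.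

(** Only [W] shrinks in the induction; colours, adjacency and paths remain those of [D]. The
    inclusion of [M] in [W] is what lets the induction exclude arcs from [M'] to [C]. *)
Lemma Borel_quasi_kernel_below (k : nat) (W : set V) :
  B W -> (forall x, W x -> (c x < k)%N) ->
  exists M, [/\ B M, M `<=` W, independent D M &
    forall x, W x -> exists m, M m /\ exists2 n, (n <= 2)%N & dipath D n x m].
Proof.
elim: k W => [|k IH] W BW Wk.
  exists set0; split=> //; first by case: B_sigma.
  by move=> x /Wk.
pose C := W `&` [set x | c x = k].
have BC : B C by exact: (sigma_setI B_sigma).
pose W' := W `\` (C `|` in_neighbours D C).
have [||M' [BM' M'W' indM' M'W]] := IH W'.
- apply: (sigma_setD B_sigma) => //; apply: (sigma_setU B_sigma) => //.
  exact: B_in.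
- move=> x [Wx nx]; have := Wk x Wx; rewrite ltnS leq_eqVlt => /orP[/eqP cx|//].
  by case: nx; left.
pose M := M' `|` (C `\` in_neighbours D M').
have path0 x : dipath D 0 x x by exists (fun=> x).
have path1 x y : arcs D (x, y) -> dipath D 1 x y.
  by move=> xy; exists (fun i => if i is 0 then x else y); split=> // -[].
exists M; split.
- apply: (sigma_setU B_sigma) => //; apply: (sigma_setD B_sigma) => //.
  exact: B_in.
- by move=> x [/M'W'[]|[[]]].
- have sym x y : Defs.adjacent D x y -> Defs.adjacent D y x by case; [right|left].
  (* An arc from [M'] to [C] would start at an in-neighbour of [C], and those are absent from [W'];
     an arc from [C] to [M'] is excluded by the choice of [M]. *)
  have CM x y : M' x -> (C `\` in_neighbours D M') y -> ~ Defs.adjacent D x y.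
    move=> M'x [Cy ny] [xy|yx]; last by apply: ny; exists x.
    by have [_] := M'W' _ M'x; apply; right; exists y.
  move=> x y [M'x|Cx] [M'y|Cy]; [exact: indM'|exact: CM|by move=> /sym; exact: CM|].
  have [[[_ /= cx] _] [[_ /= cy] _]] := (Cx, Cy).
  by case=> /c_proper; rewrite cx cy.
(* One step suffices from [C], which leaves the other one for its in-neighbours. *)
- have CM x : C x -> exists m, M m /\ exists2 n, (n <= 1)%N & dipath D n x m.
    move=> Cx; have [[m M'm xm]|nx] := pselect (in_neighbours D M' x).
      by exists m; split; [left|exists 1%N => //; exact: path1].
    by exists x; split; [right|exists 0%N].
  move=> x Wx; have [[Cx|[y Cy xy]]|nx] := pselect ((C `|` in_neighbours D C) x).
  + have [m [Mm [n n1 xm]]] := CM x Cx.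
    by exists m; split=> //; exists n => //; exact: leq_trans n1 _.
  + have [m [Mm [n n1 [p [p0 pn pS]]]]] := CM y Cy.
    exists m; split=> //; exists n.+1 => //.
    exists (fun i => if i is j.+1 then p j else x); split=> // -[_|i]; last exact: pS.
    by rewrite p0.
  + have [m [M'm xm]] := M'W x (conj Wx nx).
    by exists m; split=> //; left.
Qed.

End QuasiKernel.

Theorem theorem1p2 (R : realType) (V : Type) (B : set (set V)) (D : digraph V)
    (B_standard : standard_Borel R B)
    (D_Borel : Borel_digraph D B)
    (D_locally_countable : locally_countable D)
    (chi_finite : (Borel_chromatic_number D B R < +oo)%E) :
  exists M : set V, Borel_quasi_kernel D B R M.
Proof.
have B_sigma := standard_Borel_sigma_algebra B_standard.
(* The infimum of the empty set is [+oo], so a finite value yields a colouring. *)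
have [k [c [cB cD]]] : exists k (c : V -> 'I_k), Borel_coloring D B c.
  apply: contrapT => nk; move: chi_finite; apply/negP; rewrite -leNgt.
  by apply/ereal_infP => _ [k [c cP] <-]; case: nk; exists k, c.
have B_in A : B A -> B (in_neighbours D A).
  exact: (Borel_in_neighbours B_standard D_Borel D_locally_countable).
have B_c i : B [set x | c x = i :> nat] by exact: (cB [set j | j = i :> nat]).
have c_proper x y : arcs D (x, y) -> c x <> c y :> nat.
  by move=> xy /val_inj; apply: cD; left.
have c_lt x : [set: V] x -> (c x < k)%N by [].
have [M [BM _ indM Mdist]] :=
  Borel_quasi_kernel_below B_sigma B_in B_c c_proper (sigma_setT B_sigma) c_lt.
exists M; split=> // x; have [m [Mm [n n2 xm]]] := Mdist x I.
apply: ge_ereal_inf; exists (didist D R x m); first by exists m.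
apply: ge_ereal_inf; exists (n%:R%:E); first by exists n.
by rewrite lee_fin ler_nat.
Qed.
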